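(* Let $k$ and $r$ be positive integers. Suppose that each monomial $x_1^{i_1}\cdots x_k^{i_k}$ of $P_k$ in degree $2r+k$ with at least one exponent $i_t$ even is hit. Then $$Sq^0_* : (\mathbb{F}_2\otimes_{\mathcal{A}} P_k)_{2r+k} \longrightarrow (\mathbb{F}_2\otimes_{\mathcal{A}} P_k)_r$$ is an isomorphism of $GL_k$-modules.
   Context: $\mathcal{A}$ is the mod 2 Steenrod algebra and $\mathcal{A}^+$ its ideal of positive-degree operations. $P_k=\mathbb{F}_2[x_1,\dots,x_k]$, with each $x_i$ of degree $1$, is the mod 2 cohomology of $B\mathbb{V}_k$, where $\mathbb{V}_k$ is a $k$-dimensional $\mathbb{F}_2$-vector space; it carries the usual $\mathcal{A}$-action and the commuting action of $GL_k=GL_k(\mathbb{F}_2)$ by linear substitutions of variables. $\mathbb{F}_2\otimes_{\mathcal{A}}P_k=P_k/\mathcal{A}^+P_k$, and a subscript denotes the homogeneous part of that degree. A polynomial in $P_k$ is called hit if it is $\mathcal{A}$-decomposable, i.e. lies in $\mathcal{A}^+P_k$. Exponents equal to $0$ count as even. The map $Sq^0_*$ (the dual of Kameko's squaring operation) is the map induced on $\mathbb{F}_2\otimes_{\mathcal{A}}P_k$ by the linear map $\widetilde{Sq}^0_*:P_k\to P_k$ given by $$\widetilde{Sq}^0_*(x_1^{j_1}\cdots x_k^{j_k})=\begin{cases}x_1^{(j_1-1)/2}\cdots x_k^{(j_k-1)/2}, & j_1,\dots,j_k\text{ all odd},\\ 0, & \text{otherwise},\end{cases}$$ which is known to be $GL_k$-equivariant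 and to send $\mathcal{A}^+P_k$ into itself. *)

(* Defs.v *)
From HB Require Import structures.
From mathcomp Require Import all_boot all_order all_algebra.
From mathcomp Require Import generic_quotient ring_quotient.
From mathcomp Require Import boolp.
From mathcomp Require Import mpoly.

Set Implicit Arguments.
Unset Strict Implicit.
Unset Printing Implicit Defensive.

Import GRing.Theory.

Local Open Scope ring_scope.
Local Open Scope quotient_scope.

(* The total square [Sq(f) = \sum_n Sq^n(f) T^n]: the ring morphism (Cartan
   formula) fixing the constants and sending each [x_i], of degree 1, to
   [x_i + x_i^2 T]. *)
Definition total_Sq (k : nat) (f : {mpoly 'F_2[k]}) :
    {poly {mpoly 'F_2[k]}} :=
  mmap (polyC \o @mpolyC k 'F_2)
       (fun i => ('X_i)%:P + ('X_i ^+ 2)%:P * 'X) f.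

Definition Sq (k n : nat) (f : {mpoly 'F_2[k]}) : {mpoly 'F_2[k]} :=
  (total_Sq f)`_n.

(* [steenrod_op d a]: [a] is the endomorphism of [{mpoly 'F_2[k]}] by which some
   element of degree [d] of the Steenrod algebra acts.  Since that algebra is
   generated by the squares, these are the sums of composites
   [Sq^(i_1) \o ... \o Sq^(i_s)] with [i_1 + ... + i_s = d].  No presentation by
   the Adem relations is needed, as they act as zero. *)
Inductive steenrod_op (k : nat) :
    nat -> ({mpoly 'F_2[k]} -> {mpoly 'F_2[k]}) -> Prop :=
| steenrod_id : steenrod_op 0 id
| steenrod_0 d : steenrod_op d (fun=> 0)
| steenrod_add d a b :
    steenrod_op d a -> steenrod_op d b -> steenrod_op d (fun f => a f + b f)
| steenrod_Sq i d a :
    steenrod_op d a -> steenrod_op (i + d) (fun f => Sq i (a f)).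

(* Membership in [A^+ P_k]. *)
Definition hit (k : nat) (f : {mpoly 'F_2[k]}) : Prop :=
  exists (n : nat) (a : 'I_n -> {mpoly 'F_2[k]} -> {mpoly 'F_2[k]})
         (g : 'I_n -> {mpoly 'F_2[k]}),
    (forall i, exists2 d, (0 < d)%N & steenrod_op d (a i)) /\
    f = \sum_(i < n) a i (g i).

(* The substitution [x_j |-> \sum_i g_ij x_i]; with this convention the
   invertible matrices act on the left. *)
Definition gl_subst (k : nat) (g : 'M['F_2]_k) (f : {mpoly 'F_2[k]}) :
    {mpoly 'F_2[k]} :=
  f \mPo [tuple \sum_(i < k) g i j *: 'X_i | j < k].

(* [kameko] is the linear map written [Sq^0_*] with a tilde; [kameko_cohit] below
   is the map [Sq^0_*] it induces on the quotient. *)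
Definition kameko_mnm (k : nat) (m : 'X_{1..k}) : {mpoly 'F_2[k]} :=
  if [forall i, odd (m i)] then 'X_[[multinom ((m i).-1)./2 | i < k]] else 0.

Definition kameko (k : nat) (f : {mpoly 'F_2[k]}) : {mpoly 'F_2[k]} :=
  \sum_(m <- msupp f) f@_m *: kameko_mnm m.

Section TotalSquare.
Variable k : nat.
Implicit Types (f g : {mpoly 'F_2[k]}).

Lemma total_Sq_is_zmod_morphism : zmod_morphism (@total_Sq k).
Proof. by move=> f g; rewrite /total_Sq rmorphB. Qed.
Lemma total_Sq_is_monoid_morphism : monoid_morphism (@total_Sq k).
Proof. by split=> [|f g]; rewrite /total_Sq ?rmorph1 ?rmorphM. Qed.
HB.instance Definition _ :=
  GRing.isZmodMorphism.Build {mpoly 'F_2[k]} {poly {mpoly 'F_2[k]}}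
    (@total_Sq k) total_Sq_is_zmod_morphism.
HB.instance Definition _ :=
  GRing.isMonoidMorphism.Build {mpoly 'F_2[k]} {poly {mpoly 'F_2[k]}}
    (@total_Sq k) total_Sq_is_monoid_morphism.

Lemma total_SqX m :
  total_Sq 'X_[m] =
    \prod_(i < k) (('X_i)%:P + ('X_i ^+ 2)%:P * 'X) ^+ m i.
Proof. exact: mmapX. Qed.

Lemma total_SqZ c f : total_Sq (c *: f) = (c%:MP)%:P * total_Sq f.
Proof. exact: mmapZ. Qed.

Lemma Sq_is_linear n : linear (@Sq k n).
Proof.
by move=> c f g; rewrite /Sq rmorphD /= coefD total_SqZ coefCM mul_mpolyC.
Qed.
HB.instance Definition _ n :=
  GRing.isLinear.Build 'F_2 {mpoly 'F_2[k]} {mpoly 'F_2[k]} _ (@Sq k n)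
    (@Sq_is_linear n).

Lemma mpolyF2_ind (Q : {mpoly 'F_2[k]} -> Prop) :
  Q 0 -> (forall m f, Q f -> Q ('X_[m] + f)) -> forall f, Q f.
Proof.
move=> Q0 QX f; elim/mpolyind: f => // c m f _ nz_c Qf.
suff ->: c = 1 by rewrite scale1r; apply: QX.
by apply/eqP; case: c nz_c => -[|[|]].
Qed.

Lemma mpolyF2_sqrD f g : (f + g) ^+ 2 = f ^+ 2 + g ^+ 2.
Proof.
rewrite sqrrD -mulr_natr.
have ->: 2%:R = 0 :> {mpoly 'F_2[k]} by rewrite -mpolyC_nat pchar_Zp // mpolyC0.
by rewrite mulr0 addr0.
Qed.

Lemma mpolyF2_rmorph_eq (S : comNzRingType)
    (u v : {rmorphism {mpoly 'F_2[k]} -> S}) :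
  (forall i, u 'X_i = v 'X_i) -> u =1 v.
Proof.
move=> uv; apply: mpolyF2_ind => [|m f IH]; first by rewrite !rmorph0.
rewrite !rmorphD IH mpolyXE_id !rmorph_prod; congr (_ + _).
by apply: eq_bigr => i _; rewrite !rmorphXn /= uv.
Qed.


Lemma F2_sqr (c : 'F_2) : c ^+ 2 = c.
Proof. by apply/eqP; case: c => -[|[|]]. Qed.

Lemma mpolyF2_sqr_sum (I : Type) (r : seq I) (c : I -> 'F_2)
    (F : I -> {mpoly 'F_2[k]}) :
  (\sum_(i <- r) c i *: F i) ^+ 2 = \sum_(i <- r) c i *: F i ^+ 2.
Proof.
elim: r => [|i r IH]; first by rewrite !big_nil expr0n.
by rewrite !big_cons mpolyF2_sqrD IH exprZn F2_sqr.
Qed.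

Lemma total_SqXU i :
  total_Sq ('X_i : {mpoly 'F_2[k]}) = ('X_i)%:P + ('X_i ^+ 2)%:P * 'X.
Proof. by rewrite /total_Sq mmapX mmap1U. Qed.

Lemma gl_subst_is_linear (h : 'M['F_2]_k) : linear (gl_subst h).
Proof. by move=> c f g; rewrite /gl_subst linearP. Qed.
Lemma gl_subst_is_monoid_morphism (h : 'M['F_2]_k) :
  monoid_morphism (gl_subst h).
Proof. by split=> [|f g]; rewrite /gl_subst ?rmorph1 ?rmorphM. Qed.
HB.instance Definition _ (h : 'M['F_2]_k) :=
  GRing.isLinear.Build 'F_2 {mpoly 'F_2[k]} {mpoly 'F_2[k]} *:%R
    (@gl_subst k h) (gl_subst_is_linear h).
HB.instance Definition _ (h : 'M['F_2]_k) :=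
  GRing.isMonoidMorphism.Build {mpoly 'F_2[k]} {mpoly 'F_2[k]}
    (@gl_subst k h) (gl_subst_is_monoid_morphism h).

Lemma gl_substXU (h : 'M['F_2]_k) j :
  gl_subst h 'X_j = \sum_(i < k) h i j *: 'X_i.
Proof. by rewrite /gl_subst comp_mpolyXU -tnth_nth tnth_mktuple. Qed.

Lemma Sq_gl_subst (h : 'M['F_2]_k) n f :
  gl_subst h (Sq n f) = Sq n (gl_subst h f).
Proof.
pose u : {rmorphism _ -> _} := map_poly (@gl_subst k h) \o @total_Sq k.
pose v : {rmorphism _ -> _} := @total_Sq k \o @gl_subst k h.
suff uv : u =1 v.
  by rewrite /Sq -coef_map; congr (polyseq _)`_n; apply: uv.
apply: mpolyF2_rmorph_eq => j /=.
rewrite total_SqXU rmorphD rmorphM /= !map_polyC map_polyX /= rmorphXn /=.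
rewrite !gl_substXU mpolyF2_sqr_sum !rmorph_sum /= mulr_suml -big_split /=.
apply: eq_bigr => i _.
by rewrite total_SqZ total_SqXU -!mul_mpolyC !rmorphM /= mulrDr !mulrA.
Qed.

Lemma Sq0 f : Sq 0 f = f.
Proof.
pose u : {rmorphism _ -> _} := horner_eval 0 \o @total_Sq k.
suff u_id : u =1 idfun by rewrite /Sq -horner_coef0; apply: u_id.
by apply: mpolyF2_rmorph_eq => j /=; rewrite total_SqXU /horner_eval !hornerE.
Qed.

Lemma hit0 : hit (0 : {mpoly 'F_2[k]}).
Proof.
by exists 0%N, (fun _ => id), (fun _ => 0); split=> [[]|] //; rewrite big_ord0.
Qed.

Lemma hit_Sq n f : (0 < n)%N -> hit (Sq n f).
Proof.
move=> n_gt0; exists 1%N, (fun _ => Sq n), (fun _ => f); split=> [_|].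
  by exists n => //; rewrite -[n in steenrod_op n]addn0; apply/steenrod_Sq/steenrod_id.
by rewrite big_ord1.
Qed.

Lemma hitD f g : hit f -> hit g -> hit (f + g).
Proof.
case=> n1 [a1 [g1 [a1P ->]]] [n2 [a2 [g2 [a2P ->]]]].
pose sel T (u1 : 'I_n1 -> T) (u2 : 'I_n2 -> T) i :=
  match split i with inl j => u1 j | inr j => u2 j end.
exists (n1 + n2)%N, (sel _ a1 a2), (sel _ g1 g2); split=> [i|].
  by rewrite /sel; case: (split i).
rewrite big_split_ord; congr (_ + _); apply: eq_bigr => i _; rewrite /sel.
  by rewrite [split _](unsplitK (inl i)).
by rewrite [split _](unsplitK (inr i)).
Qed.

Lemma hit_ind (Q : {mpoly 'F_2[k]} -> Prop) :
    Q 0 -> (forall f g, Q f -> Q g -> Q (f + g)) ->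
    (forall n f, (0 < n)%N -> Q (Sq n f)) ->
  forall f, hit f -> Q f.
Proof.
move=> Q0 QD QSq f [n [a [g [aP ->]]]].
suff Qa d b : steenrod_op d b -> (0 < d)%N -> forall h, Q (b h).
  by apply: (big_ind Q) => // i _; have [d d_gt0 /Qa] := aP i; apply.
elim=> // [e b1 b2 _ IH1 _ IH2 e_gt0 h | i e c _ IH]; first by apply/QD; auto.
by case: i => [e_gt0 h|i _ h]; [rewrite Sq0; apply: IH | apply: QSq].
Qed.

Lemma hit_gl_subst (h : 'M['F_2]_k) f : hit f -> hit (gl_subst h f).
Proof.
move: f; apply: hit_ind => [|f g|n f n_gt0]; first by rewrite rmorph0 ; apply: hit0.
  by rewrite rmorphD; apply: hitD.
by rewrite Sq_gl_subst; apply: hit_Sq.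
Qed.

End TotalSquare.

Section Kameko.
Variable k : nat.
Implicit Types (f g : {mpoly 'F_2[k]}) (m : 'X_{1..k}).

Lemma mcoeff_kameko_mnm m m' :
  (kameko_mnm m)@_m' = (m == [multinom (m' i).*2.+1 | i < k])%:R.
Proof.
rewrite /kameko_mnm; case: forallP => [odd_m|even_m]; last first.
  rewrite mcoeff0; case: eqP => // m_def; case: even_m => i.
  by rewrite m_def mnmE /= odd_double.
rewrite mcoeffX; congr (_ %:R); congr (nat_of_bool _).
apply/eqP/eqP => [<-|->]; apply/mnmP=> i; rewrite !mnmE /= ?doubleK //.
by case: (m i) (odd_m i) => // n /= even_n; rewrite even_halfK.
Qed.

Lemma mcoeff_kameko f m :
  (kameko f)@_m = f@_[multinom (m i).*2.+1 | i < k].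
Proof.
rewrite /kameko [in RHS](mpolyE f) !raddf_sum /=.
by apply: eq_bigr => m' _; rewrite !mcoeffZ mcoeff_kameko_mnm mcoeffX.
Qed.

Lemma kameko_is_linear : linear (@kameko k).
Proof.
by move=> c f g; apply/mpolyP=> m; rewrite !(mcoeff_kameko, mcoeffD, mcoeffZ).
Qed.
HB.instance Definition _ :=
  GRing.isLinear.Build 'F_2 {mpoly 'F_2[k]} {mpoly 'F_2[k]} *:%R
    (@kameko k) kameko_is_linear.

Lemma kamekoX m : kameko 'X_[m] = kameko_mnm m.
Proof.
by apply/mpolyP=> m'; rewrite mcoeff_kameko mcoeff_kameko_mnm mcoeffX.
Qed.

Lemma kameko_sqrM f g : kameko (f ^+ 2 * g) = f * kameko g.
Proof.
move: f g; apply: mpolyF2_ind => [g|m f IHf g].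
  by rewrite expr0n !mul0r linear0.
rewrite mpolyF2_sqrD !mulrDl linearD /= IHf; congr (_ + _).
move: g; apply: mpolyF2_ind => [|n g IHg]; first by rewrite mulr0 linear0 mulr0.
rewrite mulrDr !linearD /= mulrDr IHg; congr (_ + _).
rewrite mpolyXn -mpolyXD !kamekoX /kameko_mnm.
have odd_eq i : odd ((m *+ 2 + n)%MM i) = odd (n i).
  by rewrite mnmDE mulmnE oddD oddM andbF.
rewrite (eq_forallb odd_eq); case: forallP => [odd_n|]; last by rewrite mulr0.
rewrite -mpolyXD; congr 'X_[_]; apply/mnmP=> i; rewrite !(mnmE, mnmDE, mulmnE).
case: (n i) (odd_n i) => // p _.
by rewrite addnS /= muln2 halfD odd_double doubleK add0n.
Qed.

Lemma kameko_odd_part (b : pred 'I_k) n :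
  kameko (\prod_(i < k | b i) (('X_i)%:P + ('X_i ^+ 2)%:P * 'X))`_n =
    ([forall i, b i] && (n == 0)%N)%:R.
Proof.
pose F i : {poly {mpoly 'F_2[k]}} :=
  if b i then ('X_i ^+ 2)%:P * 'X else 0.
pose G i : {poly {mpoly 'F_2[k]}} := if b i then ('X_i)%:P else 1.
have ->: \prod_(i < k | b i) (('X_i)%:P + ('X_i ^+ 2)%:P * 'X) =
         \prod_(i < k) (F i + G i).
  rewrite big_mkcond; apply: eq_bigr => i _; rewrite /F /G.
  by case: (b i); [rewrite addrC | rewrite add0r].
rewrite bigA_distr coef_sum linear_sum (bigD1 set0) //= [X in _ + X]big1.
  rewrite addr0.
  have ->: \prod_(i < k) (if i \in set0 then F i else G i) =
           ('X_[[multinom b i : nat | i < k]])%:P.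
    rewrite mpolyXE_id rmorph_prod /=; apply: eq_bigr => i _.
    by rewrite inE mnmE /G; case: (b i); rewrite ?expr1 ?expr0.
  rewrite coefC; case: (n == 0)%N; last by rewrite linear0 andbF.
  rewrite andbT kamekoX /kameko_mnm.
  have odd_b i : odd ([multinom b i : nat | i < k] i) = b i.
    by rewrite mnmE; case: (b i).
  rewrite (eq_forallb odd_b); case: forallP => // b_all.
  rewrite -mpolyX0; congr 'X_[_]; apply/mnmP=> i.
  by rewrite !mnmE; case: (b i).
move=> J J_neq0; have /set0Pn[j Jj] := J_neq0.
have [/existsP[i /andP[Ji b'i]]|/existsPn bJ] :=
    boolP [exists i, (i \in J) && ~~ b i].
  by rewrite (bigD1 i) //= Ji /F (negbTE b'i) mul0r coef0 linear0.
pose M := [multinom (if i \in J then 2 else b i)%N | i < k].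
have ->: \prod_(i < k) (if i \in J then F i else G i) =
         ('X_[M])%:P * 'X^(\sum_(i < k) (i \in J)).
  rewrite mpolyXE_id rmorph_prod -prodrXr -big_split /=.
  apply: eq_bigr => i _; have := bJ i; rewrite mnmE /F /G.
  by case: (i \in J); case: (b i) => //= _; rewrite ?mulr1 ?expr1 ?expr0.
rewrite coefCM coefXn mulr_natr raddfMn /= kamekoX /kameko_mnm.
case: forallP => [/(_ j)|_]; last by rewrite mul0rn.
by rewrite mnmE Jj.
Qed.

Lemma kameko_sqr_coef (A B : {poly {mpoly 'F_2[k]}}) (e : bool) :
    (forall n, kameko B`_n = (e && (n == 0)%N)%:R) ->
  forall n, kameko (A ^+ 2 * B)`_n = if odd n then 0 else A`_n./2 *+ e.
Proof.
move=> BE; elim/poly_ind: A => [|A c IH] n.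
  by rewrite expr0n mul0r !coef0 linear0 mul0rn if_same.
have ->: (A * 'X + c%:P) ^+ 2 = A ^+ 2 * 'X^2 + (c ^+ 2)%:P.
  rewrite sqrrD exprMn -polyC_exp -mulr_natr.
  have ->: 2%:R = 0 :> {poly {mpoly 'F_2[k]}}.
    by rewrite -polyC_natr -mpolyC_nat pchar_Zp // mpolyC0.
  by rewrite mulr0 addr0.
rewrite mulrDl coefD coefCM linearD /= kameko_sqrM BE mulrAC coefMXn.
case: n => [|[|n]]; rewrite /= ?negbK ?coefD ?coefMX ?coefC /=.
- by rewrite raddf0 !add0r andbT mulr_natr.
- by rewrite raddf0 add0r andbF mulr_natr mulr0n.
by rewrite subn2 /= IH andbF mulr_natr mulr0n !addr0.
Qed.

Lemma kameko_Sq n f :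
  kameko (Sq n f) = if odd n then 0 else Sq n./2 (kameko f).
Proof.
have SqD p (a b : {mpoly 'F_2[k]}) : Sq p (a + b) = Sq p a + Sq p b.
  exact: raddfD.
have kamekoD (a b : {mpoly 'F_2[k]}) : kameko (a + b) = kameko a + kameko b.
  exact: raddfD.
move: f; apply: mpolyF2_ind => [|m f IHf].
  by rewrite [Sq n 0]raddf0 [kameko 0]raddf0 [Sq _ 0]raddf0 if_same.
suff SqX :
    kameko (Sq n 'X_[m]) = if odd n then 0 else Sq n./2 (kameko 'X_[m]).
  rewrite SqD 2!kamekoD; apply: etrans (congr2 +%R SqX IHf) _.
  by case: (odd n); [rewrite addr0 | rewrite SqD].
rewrite kamekoX.
pose h := [multinom (m i)./2 | i < k].
pose B : {poly {mpoly 'F_2[k]}} :=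
  \prod_(i < k | odd (m i)) (('X_i)%:P + ('X_i ^+ 2)%:P * 'X).
have SqE : total_Sq 'X_[m] = total_Sq ('X_[h] : {mpoly 'F_2[k]}) ^+ 2 * B.
  rewrite !total_SqX /B [X in _ * X]big_mkcond -prodrXl -big_split /=.
  apply: eq_bigr => i _; rewrite mnmE -exprM muln2.
  rewrite -[in LHS](odd_double_half (m i)) exprD mulrC; congr (_ * _).
  by case: odd.
rewrite {1}/Sq SqE.
rewrite (kameko_sqr_coef _ (kameko_odd_part _)) /kameko_mnm.
case: ifP => // _; case: forallP => [odd_m|_]; last by rewrite linear0.
rewrite mulr1n /Sq; have -> // : h = [multinom ((m i).-1)./2 | i < k].
apply/mnmP=> i; rewrite !mnmE; case: (m i) (odd_m i) => //= p /negbTE.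
by rewrite uphalf_half => ->.
Qed.

Lemma hit_kameko f : hit f -> hit (kameko f).
Proof.
move: f; apply: hit_ind => [|f g|n f n_gt0].
- by rewrite linear0; apply: hit0.
- by rewrite linearD; apply: hitD.
rewrite kameko_Sq; case: ifP => [_|even_n]; first exact: hit0.
by apply: hit_Sq; case: n n_gt0 even_n => [|[]].
Qed.

Lemma kameko_homog d f :
  f \is (2 * d + k).-homog -> kameko f \is d.-homog.
Proof.
move=> /dhomogP f_homog; apply/dhomogP=> m.
rewrite mcoeff_msupp mcoeff_kameko -mcoeff_msupp => /f_homog /=.
rewrite !mdegE; under eq_bigr => i _ do rewrite mnmE -addn1 -mul2n.
rewrite big_split /= -big_distrr /= sum1_card card_ord => /addIn /eqP.
by rewrite eqn_pmul2l // => /eqP.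
Qed.

Lemma gl_subst_homog (h : 'M['F_2]_k) d f :
  f \is d.-homog -> gl_subst h f \is d.-homog.
Proof.
move=> /dhomogP f_homog; rewrite /gl_subst comp_mpolyEX big_seq.
apply: rpred_sum => m /f_homog <-; apply: rpredZ.
rewrite comp_mpolyX /= mdegE.
apply: (big_ind2 (fun (p : {mpoly 'F_2[k]}) e => p \is e.-homog)).
- exact: dhomog1.
- by move=> p e q e'; apply: dhomogM.
move=> i _; rewrite tnth_mktuple.
have lin_homog : \sum_(j < k) h j i *: 'X_j \is [in 'F_2[k], 1.-homog].
  by apply: rpred_sum => j _; apply: rpredZ; rewrite dhomogX /= mdeg1.
by have := dhomogMn (m i) lin_homog; rewrite mul1n.
Qed.

End Kameko.

Definition hit_pred (k : nat) : {pred {mpoly 'F_2[k]}} :=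
  [pred f | `[< hit f >]].
Arguments hit_pred : clear implicits.

Lemma hit_predP (k : nat) (f : {mpoly 'F_2[k]}) :
  reflect (hit f) (f \in hit_pred k).
Proof. exact: asboolP. Qed.

Lemma hit_submod_closed (k : nat) : submod_closed (hit_pred k).
Proof.
split=> [|c f g /hit_predP hit_f /hit_predP hit_g]; apply/hit_predP.
  exact: hit0.
have [->|->] : c = 0 \/ c = 1.
  by case: c => -[|[|]] // ?; [left|right]; apply: val_inj.
  by rewrite scale0r add0r.
by rewrite scale1r; apply: hitD.
Qed.
HB.instance Definition _ (k : nat) :=
  GRing.isSubmodClosed.Build 'F_2 {mpoly 'F_2[k]} (hit_pred k)
    (hit_submod_closed k).

(* [F_2 (x)_A P_k = P_k / A^+ P_k] *)
Definition cohit (k : nat) : Type := Quotient.quot (hit_pred k).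
HB.instance Definition _ (k : nat) :=
  GRing.Zmodule.copy (cohit k) (Quotient.quot (hit_pred k)).

Definition cohit_class (k : nat) (f : {mpoly 'F_2[k]}) : cohit k :=
  \pi_(Quotient.quot (hit_pred k)) f.

Definition cohit_repr (k : nat) (x : cohit k) : {mpoly 'F_2[k]} :=
  repr (x : Quotient.quot (hit_pred k)).

(* The map of quotients induced by [u]; see [cohit_mapE]. *)
Definition cohit_map (k : nat) (u : {mpoly 'F_2[k]} -> {mpoly 'F_2[k]})
    (x : cohit k) : cohit k :=
  cohit_class (u (cohit_repr x)).

Section Cohit.
Variable k : nat.
Implicit Types (f g : {mpoly 'F_2[k]}) (x y : cohit k).

Lemma cohit_reprK x : cohit_class (cohit_repr x) = x.
Proof. exact: reprK. Qed.

Lemma cohit_classP f g : cohit_class f = cohit_class g <-> hit (f - g).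
Proof.
split=> [fg|/hit_predP fg].
  by apply/hit_predP; rewrite Quotient.idealrBE; apply/eqP.
by apply/eqP; rewrite -Quotient.idealrBE.
Qed.

Lemma cohit_class_zmod_morphism : zmod_morphism (@cohit_class k).
Proof. exact: (raddfB (\pi_(Quotient.quot (hit_pred k)))). Qed.
HB.instance Definition _ :=
  GRing.isZmodMorphism.Build {mpoly 'F_2[k]} (cohit k) (@cohit_class k)
    cohit_class_zmod_morphism.

Definition cohit_scale (c : 'F_2) : cohit k -> cohit k := cohit_map ( *:%R c).

Lemma cohit_mapE (u : {additive {mpoly 'F_2[k]} -> {mpoly 'F_2[k]}}) f :
  (forall g, hit g -> hit (u g)) ->
  cohit_map u (cohit_class f) = cohit_class (u f).
Proof.
move=> u_hit; apply/cohit_classP; rewrite -raddfB; apply/u_hit/cohit_classP.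
exact: cohit_reprK.
Qed.

Lemma hitZ c f : hit f -> hit (c *: f).
Proof. by move=> /hit_predP ?; apply/hit_predP/rpredZ. Qed.

Lemma cohit_scaleE c f : cohit_scale c (cohit_class f) = cohit_class (c *: f).
Proof. by apply: cohit_mapE => g; apply: hitZ. Qed.

Lemma cohit_scalerA a b x :
  cohit_scale a (cohit_scale b x) = cohit_scale (a * b) x.
Proof. by rewrite -[x]cohit_reprK !cohit_scaleE scalerA. Qed.
Lemma cohit_scale1r : left_id 1 cohit_scale.
Proof. by move=> x; rewrite -[x]cohit_reprK cohit_scaleE scale1r. Qed.
Lemma cohit_scalerDr : right_distributive cohit_scale +%R.
Proof.
move=> a x y; rewrite -[x]cohit_reprK -[y]cohit_reprK !cohit_scaleE.
have classD f g : cohit_class f + cohit_class g = cohit_class (f + g).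
  by rewrite raddfD.
by rewrite !classD cohit_scaleE scalerDr.
Qed.
Lemma cohit_scalerDl x : {morph cohit_scale^~ x : a b / a + b}.
Proof.
move=> a b; rewrite -[x]cohit_reprK !cohit_scaleE.
have classD f g : cohit_class f + cohit_class g = cohit_class (f + g).
  by rewrite raddfD.
by rewrite classD scalerDl.
Qed.
HB.instance Definition _ :=
  GRing.Zmodule_isLmodule.Build 'F_2 (cohit k)
    cohit_scalerA cohit_scale1r cohit_scalerDr cohit_scalerDl.

Lemma cohit_class_scalable : scalable (@cohit_class k).
Proof. by move=> c f; rewrite -cohit_scaleE. Qed.
HB.instance Definition _ :=
  GRing.isScalable.Build 'F_2 {mpoly 'F_2[k]} (cohit k) *:%R
    (@cohit_class k) cohit_class_scalable.

End Cohit.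

Definition gl_cohit (k : nat) (h : 'M['F_2]_k) : cohit k -> cohit k :=
  cohit_map (gl_subst h).

Definition kameko_cohit (k : nat) : cohit k -> cohit k := cohit_map (@kameko k).

Definition cohit_homog (k d : nat) : {pred cohit k} :=
  [pred x | `[< exists2 f : {mpoly 'F_2[k]},
                  f \is d.-homog & x = cohit_class f >]].
Arguments cohit_homog : clear implicits.

Section CohitHomog.
Variables k d : nat.

Lemma cohit_homogP (x : cohit k) :
  reflect (exists2 f, f \is d.-homog & x = cohit_class f)
          (x \in cohit_homog k d).
Proof. exact: asboolP. Qed.

Lemma cohit_homog_submod_closed : submod_closed (cohit_homog k d).
Proof.
split=> [|c _ _ /cohit_homogP[f f_homog ->] /cohit_homogP[g g_homog ->]].
  by apply/cohit_homogP; exists 0; rewrite ?rpred0 ?raddf0.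
apply/cohit_homogP; exists (c *: f + g); last by rewrite linearP.
by rewrite rpredD ?rpredZ.
Qed.
HB.instance Definition _ :=
  GRing.isSubmodClosed.Build 'F_2 (cohit k) (cohit_homog k d)
    cohit_homog_submod_closed.

(* [(F_2 (x)_A P_k)_d] *)
Record cohit_deg : Type :=
  CohitDeg { cohit_of :> cohit k; _ : cohit_of \in cohit_homog k d }.
HB.instance Definition _ := [isSub for cohit_of].
HB.instance Definition _ := [Choice of cohit_deg by <:].
HB.instance Definition _ := [SubChoice_isSubLmodule of cohit_deg by <:].

End CohitHomog.

Section Induced.
Variable k : nat.
Implicit Types (f : {mpoly 'F_2[k]}) (g h : 'M['F_2]_k).

Lemma gl_cohitE h f : gl_cohit h (cohit_class f) = cohit_class (gl_subst h f).
Proof. by apply: cohit_mapE => ?; apply: hit_gl_subst. Qed.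

Lemma gl_cohit1 (x : cohit k) : gl_cohit 1%:M x = x.
Proof.
rewrite -[x]cohit_reprK gl_cohitE; congr cohit_class.
apply: (mpolyF2_rmorph_eq (v := idfun)) => j /=.
rewrite gl_substXU (bigD1 j) //= mxE eqxx scale1r big1 ?addr0 // => i.
by rewrite mxE => /negbTE->; rewrite scale0r.
Qed.

Lemma gl_cohitM g h (x : cohit k) :
  gl_cohit (g *m h) x = gl_cohit g (gl_cohit h x).
Proof.
rewrite -[x]cohit_reprK; set f := cohit_repr x.
suff substM : gl_subst (g *m h) f = gl_subst g (gl_subst h f).
  by rewrite (gl_cohitE (g *m h) f) (gl_cohitE h f) (gl_cohitE g) substM.
move: f.
pose v : {rmorphism _ -> _} := @gl_subst k g \o @gl_subst k h.
apply: (mpolyF2_rmorph_eq (v := v)) => j /=.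
rewrite !gl_substXU linear_sum /=.
under [RHS]eq_bigr => i _ do rewrite linearZ /= gl_substXU scaler_sumr.
rewrite exchange_big; apply: eq_bigr => i _; rewrite mxE scaler_suml.
by apply: eq_bigr => l _; rewrite scalerA mulrC.
Qed.

Lemma kameko_cohitE f :
  kameko_cohit (cohit_class f) = cohit_class (kameko f).
Proof. by apply: cohit_mapE => ?; apply: hit_kameko. Qed.

Lemma gl_cohit_homog h d (x : cohit_deg k d) :
  gl_cohit h x \in cohit_homog k d.
Proof.
case: x => _ /= /cohit_homogP[f f_homog ->]; rewrite gl_cohitE.
by apply/cohit_homogP; exists (gl_subst h f); first exact: gl_subst_homog.
Qed.

Lemma kameko_cohit_homog r (x : cohit_deg k (2 * r + k)) :
  kameko_cohit x \in cohit_homog k r.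
Proof.
case: x => _ /= /cohit_homogP[f f_homog ->]; rewrite kameko_cohitE.
by apply/cohit_homogP; exists (kameko f); first exact: kameko_homog.
Qed.

End Induced.

Definition gl_cohit_deg (k d : nat) (h : 'M['F_2]_k) (x : cohit_deg k d) :
    cohit_deg k d :=
  CohitDeg (gl_cohit_homog h x).

Definition kameko_deg (k r : nat) (x : cohit_deg k (2 * r + k)) :
    cohit_deg k r :=
  CohitDeg (kameko_cohit_homog x).

Definition gl_module_iso (k : nat) (V W : lmodType 'F_2)
    (actV : 'M['F_2]_k -> V -> V) (actW : 'M['F_2]_k -> W -> W)
    (phi : V -> W) : Prop :=
  [/\ linear phi, bijective phi &
      forall h, h \in unitmx -> forall x, phi (actV h x) = actW h (phi x)].

(* Main.v *)
Require Import Defs.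
From mathcomp Require Import all_boot all_order all_algebra all_fingroup.
From mathcomp Require Import boolp.
From mathcomp Require Import mpoly.

(** Write [K] for [kameko].  Every polynomial over [F_2] is a sum of terms
    [u^2 * x^b] with all exponents of [x^b] at most 1; [K] sends such a term to
    [u] if [x^b] is the full product [x_1 ... x_k], and to 0 otherwise.

    Surjectivity on cohits: [f |-> f^2 * x_1 ... x_k] ([kameko_up]) is a section
    of [K], raising degree [r] to [2r + k].

    Injectivity: the point is that every hit polynomial is the image under [K]
    of a hit polynomial ([hit_kameko_lift]), because [K Sq^{2n} = Sq^n K] gives
    [Sq^n f = K (Sq^{2n} (f^2 * x_1 ... x_k))].  If [K f] is hit, with [f]
    homogeneous of degree [2r + k], lift [K f] to a hit [F] and cut [F] down to
    its component of degree [2r + k], which is still hit ([hit_pihomog]).  Then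
    [f - F] is homogeneous of degree [2r + k] and killed by [K], so each of its
    monomials has an even exponent and is hit by assumption; hence [f] is hit.

    Equivariance already holds for polynomials: [K (h f) = det h * h (K f)] for
    every square matrix [h] ([kameko_gl_subst]), and [det h = 1] if [h] is
    invertible over [F_2].  As [h] commutes with squaring, only the square-free
    monomials [x^b] matter.  Those of degree less than [k] go under [h] to
    polynomials of degree less than [k], which [K] kills; and the coefficient of
    [x_1 ... x_k] in [h (x_1 ... x_k)] is the permanent of [h], which modulo 2
    is its determinant. *)

Import GRing.Theory.
Local Open Scope ring_scope.

Lemma mcoeff_pihomog (k d : nat) (f : {mpoly 'F_2[k]}) (m : 'X_{1..k}) :
  (pihomog mdeg d f)@_m = if mdeg m == d then f@_m else 0.
Proof.
move: f; apply: mpolyF2_ind => [|n f IHf].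
  by rewrite linear0 mcoeff0 if_same.
rewrite linearD /= !mcoeffD IHf pihomogX mcoeffX.
have [<-|n'm] := eqVneq n m; last first.
  by rewrite add0r; case: ifP => _; rewrite ?mcoeffX ?mcoeff0 ?(negPf n'm) add0r.
by case: ifP => _; rewrite ?mcoeffX ?mcoeff0 ?eqxx ?addr0.
Qed.

Lemma mdeg_doubleS (k : nat) (m : 'X_{1..k}) :
  mdeg [multinom (m i).*2.+1 | i < k] = (2 * mdeg m + k)%N.
Proof.
rewrite !mdegE; under eq_bigr => i _ do rewrite mnmE -addn1 -mul2n.
by rewrite big_split /= -big_distrr /= sum1_card card_ord.
Qed.

Lemma kameko_pihomog (k r : nat) (f : {mpoly 'F_2[k]}) :
  kameko (pihomog mdeg (2 * r + k) f) = pihomog mdeg r (kameko f).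
Proof.
apply/mpolyP => m; rewrite mcoeff_kameko !mcoeff_pihomog mdeg_doubleS.
by rewrite eqn_add2r eqn_pmul2l // mcoeff_kameko.
Qed.

Lemma kameko_homog_lt (k d : nat) (f : {mpoly 'F_2[k]}) :
  (d < k)%N -> f \is d.-homog -> kameko f = 0.
Proof.
move=> d_lt_k f_homog; apply/mpolyP => m; rewrite mcoeff_kameko mcoeff0.
apply: (dhomog_nemf_coeff f_homog); rewrite /= mdeg_doubleS.
by rewrite gtn_eqF // (leq_trans d_lt_k) ?leq_addl.
Qed.

(** Homogeneity of degree [d] for the grading of [P_k[T]] in which [T] has degree
    -1, which makes the total square preserve degrees. *)
Definition coef_homog (k d : nat) (A : {poly {mpoly 'F_2[k]}}) : Prop :=
  forall n, A`_n \is (d + n).-homog.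

Lemma coef_homog1 (k : nat) : coef_homog k 0 1.
Proof.
move=> n; rewrite coef1; case: n => [|n]; last exact: rpred0.
exact: dhomog1.
Qed.

Lemma coef_homogM (k d e : nat) (A B : {poly {mpoly 'F_2[k]}}) :
  coef_homog k d A -> coef_homog k e B -> coef_homog k (d + e) (A * B).
Proof.
move=> A_homog B_homog n; rewrite coefM; apply: rpred_sum => i _.
have -> : (d + e + n = (d + i) + (e + (n - i)))%N.
  by rewrite addnACA subnKC // -ltnS.
exact: dhomogM.
Qed.

Lemma Sq_homog (k n : nat) (m : 'X_{1..k}) :
  Sq n ('X_[m] : {mpoly 'F_2[k]}) \is (mdeg m + n).-homog.
Proof.
rewrite /Sq; move: n; suff: coef_homog k (mdeg m) (total_Sq 'X_[m]) by [].
rewrite total_SqX mdegE.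
apply: (big_ind2 (fun A d => coef_homog k d A)).
- exact: coef_homog1.
- by move=> A d B e; apply: coef_homogM.
move=> i _; elim: (m i) => [|e IHe]; first exact: coef_homog1.
rewrite exprS -add1n; apply: coef_homogM => // -[|[|n]].
- by rewrite coefD coefC coefMX addr0 dhomogX /= mdeg1.
- by rewrite coefD coefC coefMX coefC add0r mpolyXn dhomogX /= mdegMn mdeg1.
by rewrite coefD coefC coefMX coefC addr0 rpred0.
Qed.

(** The squares are homogeneous operations, so the hit polynomials form a graded
    subspace, although the polynomials that the operations are applied to in
    [hit] are arbitrary. *)
Lemma hit_pihomog (k d : nat) (f : {mpoly 'F_2[k]}) :
  hit f -> hit (pihomog mdeg d f).
Proof.
move: f; apply: hit_ind => [|f g|n f n_gt0].
- by rewrite linear0; apply: hit0.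
- by rewrite linearD; apply: hitD.
move: f; apply: mpolyF2_ind => [|m f IHf].
  by rewrite !linear0; apply: hit0.
rewrite !linearD /=; apply: (hitD _ IHf).
have [<-|ne_d] := eqVneq (mdeg m + n)%N d.
  by rewrite pihomog_dE ?Sq_homog //; apply: hit_Sq.
by rewrite (pihomog_ne0 ne_d) ?Sq_homog //; apply: hit0.
Qed.

(** Kameko's squaring operation, in terms of polynomials. *)
Definition kameko_up {k : nat} (f : {mpoly 'F_2[k]}) : {mpoly 'F_2[k]} :=
  f ^+ 2 * 'X_[[multinom 1%N | i < k]].

Lemma kameko_ones (k : nat) :
  kameko 'X_[[multinom 1%N | i < k]] = 1 :> {mpoly 'F_2[k]}.
Proof.
rewrite kamekoX /kameko_mnm.
case: forallP => [_|[i]]; last by rewrite mnmE.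
by rewrite -mpolyX0; congr 'X_[_]; apply/mnmP=> i; rewrite !mnmE.
Qed.

Lemma kameko_upK (k : nat) : cancel (@kameko_up k) (@kameko k).
Proof. by move=> f; rewrite /kameko_up kameko_sqrM kameko_ones mulr1. Qed.

(** A lift of [Sq^n f] is [Sq^{2n} (kameko_up f)]. *)
Lemma hit_kameko_lift (k : nat) (g : {mpoly 'F_2[k]}) :
  hit g -> exists2 f, hit f & kameko f = g.
Proof.
move: g; apply: hit_ind => [|f g [f' hf <-] [g' hg <-]|n f n_gt0].
- by exists 0; [exact: hit0 | rewrite linear0].
- by exists (f' + g'); [exact: hitD | rewrite linearD].
exists (Sq n.*2 (kameko_up f)); first by apply: hit_Sq; rewrite double_gt0.
by rewrite kameko_Sq odd_double doubleK kameko_upK.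
Qed.

(** The kernel of [kameko] is spanned by the monomials with an even exponent. *)
Lemma hit_kameko_ker (k d : nat) (f : {mpoly 'F_2[k]}) :
    (forall m : 'X_{1..k}, mdeg m = d -> (exists t : 'I_k, ~~ odd (m t)) ->
       hit ('X_[m] : {mpoly 'F_2[k]})) ->
  f \is d.-homog -> kameko f = 0 -> hit f.
Proof.
move=> hhit /dhomogP f_homog kf0; rewrite (mpolyE f) big_seq.
apply: big_ind => [||m m_f]; [exact: hit0 | exact: hitD|].
apply/hitZ/hhit; first exact: f_homog.
apply/existsP; rewrite -negb_forall; apply: contraL m_f => /forallP odd_m.
have m_def : m = [multinom ([multinom (m i)./2 | i < k] i).*2.+1 | i < k].
  apply/mnmP=> i; rewrite !mnmE -[LHS](odd_double_half (m i)).
  by rewrite odd_m.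
by rewrite mcoeff_msupp negbK m_def -mcoeff_kameko kf0 mcoeff0.
Qed.

(** A product of [k] variables has all exponents odd only if each variable
    occurs, hence occurs exactly once. *)
Lemma kameko_prodX (k : nat) (u : {ffun 'I_k -> 'I_k}) :
  kameko (\prod_(j < k) 'X_(u j)) = (injectiveb u)%:R :> {mpoly 'F_2[k]}.
Proof.
case: injectiveP => [u_inj|u_ninj].
  rewrite -(reindex_inj (P := xpredT) (F := fun i => 'X_i) u_inj) /=.
  rewrite -[RHS](kameko_ones k) mpolyXE_id; congr kameko.
  by apply: eq_bigr => i _; rewrite mnmE.
have [i i_u] : exists i, i \notin codom u.
  apply/existsP; rewrite -negb_forall.
  apply: contra_notN u_ninj => /forallP u_onto.
  apply/injectiveP/card_uniqP; rewrite size_map -cardE.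
  by apply: eq_card => i; rewrite u_onto.
rewrite mprodXE kamekoX.
rewrite /kameko_mnm; case: forallP => // /(_ i).
rewrite mnm_sumE big1 // => j _; rewrite mnm1E.
by apply/eqP; rewrite eqb0; apply: contraNneq i_u => <-; apply: codom_f.
Qed.

(** Expand the product of the columns of [h], seen as linear forms: the terms
    that survive are indexed by the permutations and add up to the permanent,
    which is the determinant as [-1 = 1]. *)
Lemma kameko_gl_ones (k : nat) (h : 'M['F_2]_k) :
  kameko (gl_subst h 'X_[[multinom 1%N | i < k]]) = (\det h)%:MP.
Proof.
rewrite mpolyXE_id rmorph_prod /=.
under eq_bigr => j _ do rewrite mnmE expr1 gl_substXU.
rewrite bigA_distr_bigA linear_sum /=.
under eq_bigr => u _ do rewrite scaler_prod linearZ /= kameko_prodX.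
rewrite (bigID (fun u : {ffun 'I_k -> 'I_k} => injectiveb u)) /= addrC.
rewrite big1 ?add0r => [|u /negPf->]; last by rewrite scaler0.
rewrite (reindex (@pval _)) /=; last first.
  pose in_Sn := insubd (1%g : 'S_k).
  by exists in_Sn => /= u Uu; first apply: val_inj; apply: insubdK.
rewrite -det_tr /determinant rmorph_sum /=.
apply: eq_big => [s|s _]; first exact: (valP s).
rewrite (valP s) -mul_mpolyC mulr1 pvalE; congr _%:MP.
have -> : -1 = 1 :> 'F_2 by apply: val_inj.
by rewrite expr1n mul1r; apply: eq_bigr => i _; rewrite mxE.
Qed.

(** Multiplying [f] by [u^2] multiplies both sides by [gl_subst h u], which
    reduces the identity to the square-free monomials. *)
Lemma kameko_gl_subst (k : nat) (h : 'M['F_2]_k) (f : {mpoly 'F_2[k]}) :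
  kameko (gl_subst h f) = \det h *: gl_subst h (kameko f).
Proof.
move: f; apply: mpolyF2_ind => [|m f IHf]; first by rewrite !linear0.
rewrite !linearD /=; apply: (congr2 +%R _ IHf).
pose b := [multinom odd (m i) : nat | i < k].
have -> : 'X_[m] = ('X_[[multinom (m i)./2 | i < k]]) ^+ 2 * 'X_[b]
            :> {mpoly 'F_2[k]}.
  rewrite mpolyXn -mpolyXD; congr 'X_[_]; apply/mnmP=> i.
  by rewrite mnmDE mulmnE !mnmE muln2 addnC odd_double_half.
rewrite rmorphM rmorphXn /= !kameko_sqrM rmorphM /=.
rewrite scalerAr; apply: congr1.
have [/forallP odd_m|/existsP[j even_j]] := boolP [forall i, odd (m i)].
  have -> : b = [multinom 1%N | i < k].
    by apply/mnmP=> i; rewrite !mnmE odd_m.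
  by rewrite kameko_gl_ones kameko_ones rmorph1 -mul_mpolyC mulr1.
have b_lt_k : (mdeg b < k)%N.
  rewrite mdegE (bigD1 j) //= mnmE (negPf even_j) add0n.
  rewrite -[X in (_ < X)%N]card_ord -sum1_card [X in (_ < X)%N](bigD1 j) //=.
  rewrite add1n ltnS; apply: leq_sum => i _.
  by rewrite mnmE leq_b1.
have Xb_homog : 'X_[b] \is [in 'F_2[k], (mdeg b).-homog] by rewrite dhomogX.
rewrite (kameko_homog_lt _ _ _ b_lt_k Xb_homog) linear0 scaler0.
by rewrite (kameko_homog_lt _ _ _ b_lt_k) // gl_subst_homog.
Qed.

Lemma kameko_cohit_linear (k : nat) : linear (@kameko_cohit k).
Proof.
move=> c x y; rewrite -[x]cohit_reprK -[y]cohit_reprK -linearP.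
by rewrite !kameko_cohitE linearP [LHS]linearP.
Qed.

(** This is the injectivity of the map induced on cohits in degree [2r + k]. *)
Lemma hit_of_hit_kameko (k r : nat) (f : {mpoly 'F_2[k]}) :
    (forall m : 'X_{1..k}, mdeg m = (2 * r + k)%N ->
       (exists t : 'I_k, ~~ odd (m t)) -> hit ('X_[m] : {mpoly 'F_2[k]})) ->
  f \is (2 * r + k).-homog -> hit (kameko f) -> hit f.
Proof.
move=> hhit f_homog /hit_kameko_lift[F F_hit kF].
(* The lift F need not be homogeneous; its component of degree 2r + k also lifts
   kameko f, which has degree r. *)
rewrite -[f](subrK (pihomog mdeg (2 * r + k) F)); apply: hitD.
  apply: (hit_kameko_ker _ _ _ hhit); first by rewrite rpredB ?pihomogP.
  by rewrite linearB /= kameko_pihomog kF pihomog_dE ?subrr ?kameko_homog.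
exact: hit_pihomog.
Qed.

Lemma kameko_up_homog (k r : nat) (f : {mpoly 'F_2[k]}) :
  f \is r.-homog -> kameko_up f \is (2 * r + k).-homog.
Proof.
move=> f_homog; apply: dhomogM; first by rewrite mulnC; apply: dhomogMn.
rewrite dhomogX /= mdegE.
by under eq_bigr => i _ do rewrite mnmE; rewrite sum1_card card_ord.
Qed.

Theorem proposition1p3 (k r : nat) (hk : (0 < k)%N) (hr : (0 < r)%N)
    (hhit : forall m : 'X_{1..k},
        mdeg m = (2 * r + k)%N -> (exists t : 'I_k, ~~ odd (m t)) ->
        hit ('X_[m] : {mpoly 'F_2[k]})) :
  gl_module_iso (@gl_cohit_deg k (2 * r + k)%N) (@gl_cohit_deg k r)
    (@kameko_deg k r).
Proof.
split.
- by move=> c x y; apply: val_inj; apply: kameko_cohit_linear.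
- have inj : injective (@kameko_deg k r).
    move=> [x xP] [y yP] /(congr1 val) /=.
    have /cohit_homogP[f f_homog fE] := xP.
    have /cohit_homogP[g g_homog gE] := yP.
    rewrite {1}fE {1}gE !kameko_cohitE.
    move=> /cohit_classP; rewrite -linearB => fg_hit; apply: val_inj.
    rewrite /= fE gE; apply/cohit_classP.
    apply: (hit_of_hit_kameko _ _ _ hhit) fg_hit.
    by rewrite rpredB.
  have /choice[up upK] y : exists x, @kameko_deg k r x = y.
    case: y => y yP; have /cohit_homogP[g g_homog gE] := yP.
    have xP : cohit_class (kameko_up g) \in cohit_homog k (2 * r + k).
      by apply/cohit_homogP; exists (kameko_up g); first exact: kameko_up_homog.
    exists (CohitDeg xP); apply: val_inj => /=.
    by rewrite kameko_cohitE kameko_upK gE.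
  by exists up => // x; apply: inj; rewrite upK.
move=> h; rewrite unitmxE unitfE => det_neq0 [x xP].
have /cohit_homogP[f f_homog fE] := xP.
apply: val_inj; rewrite /= fE gl_cohitE !kameko_cohitE gl_cohitE.
rewrite kameko_gl_subst; have -> : \det h = 1; last by rewrite scale1r.
by apply/eqP; move: det_neq0; case: (\det h) => -[|[|]].
Qed.
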